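(* Let $d>2$ be an integer, and let $a,n$ be integers with $0\le a\le n-d$. Then the non-ballot $\preceq$-minimal sets in $\operatorname{osh}\left(\binom{[n]}a\cup\binom{[n]}{a+d}\right)$ are exactly the following: - $S_{m,j}:=\{2,4,\ldots,2m,\;2m+d,2m+d+1,\ldots,2m+2d+j-1\}$, where $m,j\geq0$ are integers and $t_{min}(S_{m,j})=j+1\leq M_1:=\min\{d,\;a-m+1,\;n-m-a-d+1,\;n-2m-2d+2\}$; - $S'_{m,r}:=\{2,4,\ldots,2m,\;2m+d,2m+d+1,\ldots,2m+3d-2,\;2m+3d,2m+3d+2,\ldots,2m+3d+2r\}$, where $m,r\geq 0$ are integers and $t_{min}(S'_{m,r})=d\leq M_2:=\min\{a-m-r,\;n-m-r-a-d,\;n-2m-2r-2d\}$. (In $S_{m,j}$ the initial part consists of the even numbers from $2$ to $2m$, followed by all integers in $[2m+d,2m+2d+j-1]$; in $S'_{m,r}$ it is followed by all integers in $[2m+d,2m+3d-2]$ and then by the numbers $2m+3d+2i$ for $0\le i\le r$.)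
   Context: $[n]=\{1,\ldots,n\}$; $[a,b]=\{a,a+1,\ldots,b\}$, which is empty if $a>b$; $\mathcal{P}(A)$ is the set of all subsets of $A$ and $\binom{A}{k}$ the collection of all $k$-element subsets of $A$. Order shattering. Let $S\subseteq[n]$ and $\mathcal{F}\subseteq\mathcal{P}([n])$. Inductively: $S=\varnothing$ is order shattered by $\mathcal{F}$ iff $\mathcal{F}\neq\varnothing$. If $S=\{s_1<s_2<\cdots<s_k\}$ with $k\ge1$, then $S$ is order shattered by $\mathcal{F}$ iff there exist disjoint families $\widetilde{\mathcal{F}_0},\widetilde{\mathcal{F}_1}\subseteq\mathcal{F}$, each of size $2^{k-1}$, such that, with $T=[s_k+1,n]$ (possibly empty): (a) $T\cap C=T\cap D$ for all $C\in\widetilde{\mathcal{F}_0}$ and $D\in\widetilde{\mathcal{F}_1}$; (b) $s_k\notin C$ and $s_k\in D$ for all $C\in\widetilde{\mathcal{F}_0}$ and $D\in\widetilde{\mathcal{F}_1}$; (c) each of $\widetilde{\mathcal{F}_0}$ and $\widetilde{\mathcal{F}_1}$ individually order shatters $S\setminus\{s_k\}$. Then $\operatorname{osh}(\mathcal{F})=\{S\subseteq[n]:\mathcal{F}\text{ order shatters }S\}$. For an integer $t\ge0$, a set $S=\{s_1<\cdots<s_k\}\subseteq[n]$ is a $t$-ballot set if $s_i\ge 2i-t$ for every $i\in[k]$. A ballot set is a $0$-ballot set; a set is non-ballot if it is not a ballot set. $t_{min}(S)$ is the smallest non-negative integer $t$ such that $S$ is a $t$-ballot set. Partial order $\preceq$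 on $\mathcal{P}([n])$: sets of different sizes are incomparable; if $S=\{s_1<\cdots<s_k\}$ and $S'=\{s_1'<\cdots<s_k'\}$, then $S\preceq S'$ iff $s_i\le s_i'$ for every $i\in[k]$. $S\prec S'$ means $S\preceq S'$ and $S\ne S'$. A $\preceq$-minimal set in a family is a member $S$ of the family such that no member $S'$ of the family satisfies $S'\prec S$. *)

(* Defs.v *)
From mathcomp Require Import all_boot all_order all_algebra.

Set Implicit Arguments.
Unset Strict Implicit.
Unset Printing Implicit Defensive.

Import Order.TTheory GRing.Theory Num.Theory.

(* [n] = {1, ..., n} is represented by 'I_n, with x : 'I_n standing for the
   integer x.+1. *)

Section Subsets.

Variable n : nat.
Implicit Types (S C D : {set 'I_n}) (F : {set {set 'I_n}}).

Definition layer (k : nat) : {set {set 'I_n}} := [set C : {set 'I_n} | #|C| == k].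

Definition above (s : 'I_n) : {set 'I_n} := [set x : 'I_n | s < x].

Inductive order_shatters : {set {set 'I_n}} -> {set 'I_n} -> Prop :=
| order_shatters0 F : F != set0 -> order_shatters F set0
| order_shattersS F S (s : 'I_n) (F0 F1 : {set {set 'I_n}}) :
    s \in S -> (forall x, x \in S -> x <= s) ->
    F0 \subset F -> F1 \subset F -> [disjoint F0 & F1] ->
    #|F0| = 2 ^ #|S|.-1 -> #|F1| = 2 ^ #|S|.-1 ->
    (forall C D, C \in F0 -> D \in F1 -> above s :&: C = above s :&: D) ->
    (forall C D, C \in F0 -> D \in F1 -> s \notin C /\ s \in D) ->
    order_shatters F0 (S :\ s) -> order_shatters F1 (S :\ s) ->
    order_shatters F S.

Definition osh F : {set 'I_n} -> Prop := fun S => order_shatters F S.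

(* For 1 <= i <= #|S|, [elt S i] is the i-th smallest element s_i of S, as an
   integer of [1, n]: the enumeration of a set of ordinals is increasing. *)
Definition elt S (i : nat) : nat := nth 0 [seq (x : 'I_n).+1 | x <- enum S] i.-1.

Definition t_ballot (t : nat) S : bool :=
  all (fun i => 2 * i <= elt S i + t) (iota 1 #|S|).

Definition ballot S : bool := t_ballot 0 S.

Lemma ex_t_ballot S : exists t, t_ballot t S.
Proof.
exists (2 * #|S|); apply/allP => i; rewrite mem_iota add1n ltnS => /andP[_ le_iS].
by rewrite (leq_trans _ (leq_addl _ _)) // leq_mul2l.
Qed.

Definition tmin S : nat := ex_minn (ex_t_ballot S).

Definition prec_eq S S' : Prop :=
  #|S| = #|S'| /\ (forall i, 1 <= i <= #|S| -> elt S i <= elt S' i).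

Definition prec S S' : Prop := prec_eq S S' /\ S <> S'.

Definition prec_minimal (P : {set 'I_n} -> Prop) S : Prop :=
  P S /\ ~ (exists S', P S' /\ prec S' S).

(* The set of those members of s that lie in [n]. *)
Definition set_of_seq (s : seq nat) : {set 'I_n} := [set x : 'I_n | x.+1 \in s].

End Subsets.

Definition evens (m : nat) : seq nat := [seq 2 * i | i <- iota 1 m].

(* [index_iota p q] is the integer interval [p, q - 1].  The condition
   j + 1 <= M1 (resp. d <= M2) forces every listed number to be at most n, so
   that [set_of_seq] discards nothing for the parameters that matter. *)
Definition S_mj (n d m j : nat) : {set 'I_n} :=
  set_of_seq n (evens m ++ index_iota (2 * m + d) (2 * m + 2 * d + j)).

Definition S'_mr (n d m r : nat) : {set 'I_n} :=
  set_of_seq n (evens m ++ index_iota (2 * m + d) (2 * m + 3 * d - 1)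
                        ++ [seq 2 * m + 3 * d + 2 * i | i <- iota 0 r.+1]).

Local Open Scope ring_scope.

(* Integer-valued, since the entries of the minima may be negative. *)
Definition M1 (n a d m : nat) : int :=
  Num.min d%:Z
    (Num.min (a%:Z - m%:Z + 1)
       (Num.min (n%:Z - m%:Z - a%:Z - d%:Z + 1)
                (n%:Z - 2 * m%:Z - 2 * d%:Z + 2))).

Definition M2 (n a d m r : nat) : int :=
  Num.min (a%:Z - m%:Z - r%:Z)
    (Num.min (n%:Z - m%:Z - r%:Z - a%:Z - d%:Z)
             (n%:Z - 2 * m%:Z - 2 * r%:Z - 2 * d%:Z)).

(* Main.v *)
Require Import Defs.
From mathcomp Require Import all_boot all_order all_algebra zify.

(** Encode a set [S] by the walk that starts at 0, goes down at the elements of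
    [S] and up at the other integers of [[n]].  After [k] steps it is at
    [k - 2 u], where [u] is the number of elements of [S] in [[k]], and [S] is
    [t]-ballot exactly when its walk never goes below [-t].

    Order shattering peels off largest elements.  If [n] is not in [S], then [S]
    is order shattered by [F] iff it is by one of the two families obtained by
    prescribing whether [n] belongs to the members of [F]; if [n] is in [S], iff
    [S] minus [n] is order shattered by both ([order_shatters_notin],
    [order_shatters_in]).  When membership in [F] depends on the cardinality
    only, all that has to be remembered is the number [c] of elements prescribed
    so far, and [order_shatters_peel] turns order shattering into a recursion on
    sets of integers: let [I_k] be the set of [b] such that the part of [S] in
    [[k]] is order shattered by the restriction to [[k]] of the family with [a]
    replaced by [b]; then [I_(k+1)] is the union or the intersection of [I_k]
    and [I_k + 1].

    For the layers [a] and [a + d], [I_0 = {-d, 0}].  Going up lengthens the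
    intervals that make up [I_k] by one, going down shortens them by one.  As
    long as the walk stays nonnegative there are two intervals, of length one
    more than the height of the walk; they merge into a single interval, longer
    by [d], once the walk reaches height [d - 1], and the latter survives as
    long as the walk stays at least [-d] ([peel_two_layers]).  Hence a non-ballot
    set [S] belongs to osh iff its walk reaches [d - 1] before it becomes
    negative, never goes below [-d], and [a + |S| <= n], [|S| <= a + d].

    If [m] elements of [S] precede such a visit to height [d - 1], then
    [s_i >= 2 i] for [i <= m], while the later ones satisfy [s_i >= 2 i - d] and
    [s_i >= m + d + i - 1].  Conversely these lower bounds give back the
    condition on the walk ([osh_dominates]).  So, among the sets of size [k], the
    non-ballot members of osh are the non-ballot sets that lie above one of the
    sets [lowest_set n d m k] whose elements are those lower bounds.  These are
    incomparable for distinct [m] ([lowest_inj]), hence they are the minimal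
    sets ([minimal_nonballotP]).  The lower bound [2 i - d] takes over at
    [i = m + 2 d], and according to whether it is used one gets the sets
    [S'_mr] or the sets [S_mj]. *)

Set Implicit Arguments.
Unset Strict Implicit.
Unset Printing Implicit Defensive.

Import Order.TTheory.

(** * Order shattering and the largest element *)

Section OrderShattering.

Variable n : nat.
Implicit Types (S C D U : {set 'I_n}) (F G : {set {set 'I_n}}) (k : nat).

Definition tail k : {set 'I_n} := [set x : 'I_n | k <= x].

Definition below S k : {set 'I_n} := [set x in S | x < k].

Definition trace F k U : {set {set 'I_n}} := [set C in F | C :&: tail k == U].

Lemma tailI k l C : k <= l -> C :&: tail k :&: tail l = C :&: tail l.
Proof.
move=> le_kl; apply/setP => x; rewrite !inE -andbA; congr (_ && _).
by rewrite andb_idl //; apply: leq_trans.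
Qed.

Lemma order_shatters_sub F G S :
  F \subset G -> order_shatters F S -> order_shatters G S.
Proof.
move=> FG FS.
case: FS FG => {F S}[F F_n0|F S s F0 F1 sS smax F0F F1F dis c0 c1 ab sep FS0 FS1] FG.
  by apply: order_shatters0; apply: subset_neq0 FG F_n0.
by apply: (@order_shattersS _ _ _ s F0 F1) => //; apply: subset_trans FG.
Qed.

Lemma order_shatters_set0 F : order_shatters F set0 <-> F != set0.
Proof.
split; last exact: order_shatters0.
move: {-2}set0 (erefl (@set0 'I_n)) => S S0 FS.
case: FS S0 => // {}F {}S s F0 F1 sS _ _ _ _ _ _ _ _ _ _ S0.
by rewrite S0 inE in sS.
Qed.

(** A family that order shatters [S] contains one of the least possible size
    whose members agree beyond [S]: the two halves at the top element of [S]
    have a common trace above it, and their union has size [2 ^ #|S|].  This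
    supplies both the exact cardinalities and the common trace that the
    definition requires of the halves at the next element. *)
Lemma order_shatters_trace F S k :
    (forall x, x \in S -> x < k) -> order_shatters F S ->
  exists U, exists2 G : {set {set _}}, G \subset trace F k U
    & #|G| = 2 ^ #|S| /\ order_shatters G S.
Proof.
move=> ltSk FS; case: FS ltSk => {F S}
    [F /set0Pn[C CF] _|F S s F0 F1 sS smax F0F F1F dis c0 c1 ab sep FS0 FS1 ltSk].
  exists (C :&: tail k), [set C]; first by rewrite sub1set !inE CF eqxx.
  rewrite cards1 cards0; split=> //.
  by apply: order_shatters0; rewrite -cards_eq0 cards1.
have [C0 C0F] : exists C, C \in F0 by apply/card_gt0P; rewrite c0 expn_gt0.
have [D0 D0F] : exists D, D \in F1 by apply/card_gt0P; rewrite c1 expn_gt0.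
have tailE C D : above s :&: C = above s :&: D -> C :&: tail k = D :&: tail k.
  have le_sk : s.+1 <= k by exact: ltSk.
  have -> : above s = tail s.+1 by apply/setP => x; rewrite !inE.
  by rewrite !(setIC (tail _)) -(tailI C le_sk) -(tailI D le_sk) => ->.
exists (C0 :&: tail k), (F0 :|: F1).
  apply/subsetP => C; rewrite !inE => /orP[CF|CF].
    rewrite (subsetP F0F) //=; apply/eqP/tailE.
    by rewrite (ab C D0) // (ab C0 D0).
  by rewrite (subsetP F1F) //=; apply/eqP/tailE; rewrite (ab C0 C).
split.
  rewrite cardsU disjoint_setI0 // cards0 subn0 c0 c1 addnn -mul2n -expnS.
  by rewrite prednK //; apply/card_gt0P; exists s.
by apply: (@order_shattersS _ _ _ s F0 F1) => //; rewrite ?subsetUl ?subsetUr.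
Qed.

(** The trace on [tail x.+1] splits into two traces on [tail x], and the boolean
    [b] tells which: it is the truth value of membership of [x]. *)
Lemma trace_sub F (x : 'I_n) (b : bool) U :
    U \subset tail x.+1 ->
  trace F x (if b then x |: U else U) \subset trace F x.+1 U.
Proof.
move=> UT; apply/subsetP => C; rewrite !inE => /andP[-> /eqP CU] /=.
rewrite -(tailI C (leqnSn x)) CU; apply/eqP/setP => y.
have := subsetP UT y; case: b {CU}; rewrite !inE; case: (y \in U) => /= [->|_] //.
  by rewrite orbT.
by rewrite orbF; case: eqP => //= ->; rewrite ltnn.
Qed.

Lemma in_trace_ord F (x : 'I_n) U C :
    C \in trace F x.+1 U ->
  C \in trace F x (if x \in C then x |: U else U).
Proof.
rewrite !inE => /andP[-> /eqP<-] /=; apply/eqP/setP => y.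
case: ifP => xC; rewrite !inE leq_eqVlt (eq_sym (x : nat)).
  by case: eqVneq => [/val_inj->|ne] /=; rewrite ?xC ?eqxx // -val_eqE (negPf ne).
by case: eqVneq => [/val_inj->|ne] //=; rewrite xC.
Qed.

Lemma trace_ordP F (x : 'I_n) (b : bool) U C : U \subset tail x.+1 ->
  C \in trace F x (if b then x |: U else U) -> (x \in C) = b.
Proof.
move=> UT; rewrite inE => /andP[_ /eqP CU].
have := congr1 (fun A : {set _} => x \in A) CU; rewrite !inE leqnn andbT => ->.
case: b {CU}; rewrite ?setU11 //; apply/negbTE/negP => /(subsetP UT).
by rewrite inE ltnn.
Qed.

(** A shattering family of the kind given by [order_shatters_trace] agrees on
    [x] as well, so it lies on one side of the splitting at [x]. *)
Lemma order_shatters_notin F S (x : 'I_n) U :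
    U \subset tail x.+1 -> (forall y, y \in S -> y < x) ->
  order_shatters (trace F x.+1 U) S <->
  order_shatters (trace F x U) S \/ order_shatters (trace F x (x |: U)) S.
Proof.
move=> UT ltSx; split; last first.
  by case; apply: order_shatters_sub;
    [exact: (@trace_sub _ _ false) | exact: (@trace_sub _ _ true)].
move=> /(order_shatters_trace ltSx)[V [G GV [cG GS]]].
have [C CG] : exists C, C \in G by apply/card_gt0P; rewrite cG expn_gt0.
have GW : G \subset trace F x (if x \in C then x |: U else U).
  apply/subsetP => D DG; have := subsetP GV D DG; have := subsetP GV C CG.
  rewrite ![_ \in trace _ x V]in_set => /andP[CF /eqP CV] /andP[DF /eqP DV].
  have := in_trace_ord CF; rewrite in_set CV => /andP[_ /eqP<-].
  by rewrite inE DV eqxx andbT; move: DF; rewrite inE => /andP[].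
by move: GW; case: ifP => _ GW; [right|left]; apply: order_shatters_sub GW GS.
Qed.

(** The two halves at the top element [x] lie on the two sides of the splitting
    at [x].  Conversely, cutting down shattering families on both sides to size
    [2 ^ #|S|] gives admissible halves. *)
Lemma order_shatters_in F S (x : 'I_n) U :
    U \subset tail x.+1 -> (forall y, y \in S -> y < x) ->
  order_shatters (trace F x.+1 U) (x |: S) <->
  order_shatters (trace F x U) S /\ order_shatters (trace F x (x |: U)) S.
Proof.
move=> UT ltSx.
have xNS : x \notin S by apply/negP => /ltSx; rewrite ltnn.
have xSE : (x |: S) :\ x = S by rewrite setU1K.
have cxS : #|x |: S|.-1 = #|S| by rewrite cardsU1 xNS.
split=> [xFS|[FS0 FS1]].
  move: {1 3}(x |: S) (erefl (x |: S)) xFS => S' S'E FS'.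
  move: {1 3}(trace F x.+1 U) (erefl (trace F x.+1 U)) FS' => F' F'E FS'.
  case: FS' S'E F'E => {S' F'}
    [F' _ /esym/eqP|F' S' s F0 F1 sS smax F0F F1F _ _ _ _ sep FS0 FS1].
    by rewrite setU_eq0 -cards_eq0 cards1.
  move=> S'E F'E; subst F' S'; have sx : s = x.
    apply/val_inj/eqP; rewrite eqn_leq smax ?setU11 // andbT.
    by move: sS; rewrite in_setU1 => /predU1P[->//|/ltSx/ltnW].
  subst s; rewrite xSE in FS0 FS1.
  have [[C0 C0F] [D0 D0F]] : (exists C, C \in F0) /\ (exists D, D \in F1).
    have ne F2 S2 : order_shatters F2 S2 -> exists C, C \in F2.
      have lt_n y : y \in S2 -> y < n by rewrite ltn_ord.
      move=> /(order_shatters_trace lt_n)[V [G GV [cG _]]].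
      have [C CG] : exists C, C \in G by apply/card_gt0P; rewrite cG expn_gt0.
      by exists C; move: (subsetP GV _ CG); rewrite inE => /andP[].
    by split; [apply: ne FS0 | apply: ne FS1].
  split; [apply: order_shatters_sub FS0|apply: order_shatters_sub FS1];
    apply/subsetP => C CF.
    have := in_trace_ord (subsetP F0F C CF).
    by have [/negbTE-> _] := sep C D0 CF D0F.
  have := in_trace_ord (subsetP F1F C CF).
  by have [_ ->] := sep C0 C C0F CF.
have [V0 [G0 G0V [c0 G0S]]] := order_shatters_trace ltSx FS0.
have [V1 [G1 G1V [c1 G1S]]] := order_shatters_trace ltSx FS1.
have subT (H : {set {set 'I_n}}) k V V' :
    H \subset trace (trace F k V) k V' -> H \subset trace F k V.
  move=> HV; apply: (subset_trans HV).
  by apply/subsetP => C; rewrite in_set => /andP[].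
have G0U := subT _ _ _ _ G0V; have G1U := subT _ _ _ _ G1V.
have sep C D : C \in G0 -> D \in G1 -> x \notin C /\ x \in D.
  move=> /(subsetP G0U) CU /(subsetP G1U) DU.
  by rewrite (@trace_ordP F x true U D) // (@trace_ordP F x false U C).
have G0T := subset_trans G0U (@trace_sub F x false U UT).
have G1T := subset_trans G1U (@trace_sub F x true U UT).
apply: (@order_shattersS _ _ _ x G0 G1) => //; rewrite ?cxS ?xSE ?setU11 //.
- by move=> y; rewrite in_setU1 => /predU1P[->//|/ltSx/ltnW].
- rewrite -setI_eq0; apply/eqP/setP => C; rewrite !inE.
  apply/negP => /andP[CG0 CG1].
  by have [/negP] := sep C C CG0 CG1.
have aboveE : above x = tail x.+1 by apply/setP => y; rewrite !inE.
move=> C D /(subsetP G0T) + /(subsetP G1T).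
rewrite aboveE !(setIC (tail _)) !in_set.
by move=> /andP[_ /eqP->] /andP[_ /eqP->].
Qed.

(** The recursion to which the two splitting lemmas reduce order shattering for
    a family defined by a predicate [P] on cardinalities: [s] is the indicator
    function of [S], shifted to start from 0, and [c] is the number of elements
    from position [k] on that the members of the family have been prescribed to
    contain. *)
Fixpoint peel (s P : nat -> bool) k c : bool :=
  if k is k'.+1 then
    if s k' then peel s P k' c && peel s P k' c.+1
            else peel s P k' c || peel s P k' c.+1
  else P c.

Lemma order_shatters_peel (P : nat -> bool) S (s : nat -> bool) :
    (forall x : 'I_n, s x = (x \in S)) ->
  order_shatters [set C : {set 'I_n} | P #|C|] S <-> peel s P n 0.
Proof.
move=> sE; set F := [set C | _].
(* Only the part of [S] before [k] is shattered, by the members of [F] whose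
   part from [k] on is [U]; they enter the recursion through [#|U|] alone. *)
suff main k U : k <= n -> U \subset tail k ->
    order_shatters (trace F k U) (below S k) <-> peel s P k #|U|.
  have := main n set0 (leqnn n) (sub0set _).
  have -> : trace F n set0 = F.
    apply/setP => C; rewrite inE andb_idr // => _; apply/eqP/setP => x.
    by rewrite !inE leqNgt ltn_ord andbF.
  have -> : below S n = S by apply/setP => x; rewrite inE ltn_ord andbT.
  by rewrite cards0.
elim: k U => [|k IH] U lekn UT /=.
  have -> : below S 0 = set0 by apply/setP => x; rewrite !inE andbF.
  have tail0 C : C :&: tail 0 = C by apply/setP => x; rewrite !inE andbT.
  rewrite order_shatters_set0; split=> [/set0Pn[C]|PU].
    by rewrite !inE tail0 => /andP[PC /eqP<-].
  by apply/set0Pn; exists U; rewrite !inE tail0 PU eqxx.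
pose x := Ordinal lekn.
have ltkx y : y \in below S k -> y < x by rewrite inE => /andP[].
have xNU : x \notin U by apply/negP => /(subsetP UT); rewrite inE ltnn.
have UTk : U \subset tail k.
  by apply: (subset_trans UT); apply/subsetP => y; rewrite !inE => /ltnW.
have xUTk : x |: U \subset tail k by rewrite subUset sub1set UTk inE leqnn.
have [lek IHU] := (ltnW lekn, IH U (ltnW lekn) UTk).
have := IH (x |: U) lek xUTk; rewrite cardsU1 xNU add1n => IHxU.
have belowS : below S k.+1 = if s k then x |: below S k else below S k.
  apply/setP => y; rewrite -[s k]/(s x) sE.
  case: ifP => xS; rewrite !inE ltnS leq_eqVlt -[_ == k]/(y == x);
  by case: eqVneq => [->|//] /=; rewrite xS ?ltnn.
rewrite belowS; case: ifP => _.
  rewrite (@order_shatters_in F (below S k) x U UT ltkx) IHU IHxU.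
  by split=> /andP.
rewrite (@order_shatters_notin F (below S k) x U UT ltkx) IHU IHxU.
by split=> /orP.
Qed.

End OrderShattering.

(** * The recursion for two layers *)

(** In this part, [u j] is the number of elements of [S] in [[j]], and the walk
    of [S] is at height [j - 2 * u j] after [j] steps. *)
Definition walk_above (u : nat -> nat) t k :=
  all (fun j => 2 * u j <= j + t) (iota 0 k.+1).

(** The walk reaches height [d - 1] before it becomes negative; the inequality
    is written without subtraction. *)
Definition merged u d k :=
  has (fun p => (2 * u p + d <= p.+1) && walk_above u 0 p) (iota 0 k.+1).

Lemma walk_aboveP u t k :
  reflect (forall j, j <= k -> 2 * u j <= j + t) (walk_above u t k).
Proof. by apply: (iffP allP) => w j; have := w j; rewrite mem_iota. Qed.

Lemma mergedP u d k :
  reflect (exists2 p, p <= k & 2 * u p + d <= p.+1 /\ walk_above u 0 p)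
    (merged u d k).
Proof.
by apply: (iffP hasP) => [[p] + /andP[]|[p ? [? ?]]];
  [rewrite mem_iota; exists p | exists p; [rewrite mem_iota|apply/andP]].
Qed.

Lemma walk_aboveS u t k :
  walk_above u t k.+1 = walk_above u t k && (2 * u k.+1 <= k.+1 + t).
Proof. by rewrite /walk_above -(addn1 k.+1) iotaD all_cat /= andbT. Qed.

Lemma mergedS u d k :
  merged u d k.+1 =
    merged u d k || (2 * u k.+1 + d <= k.+2) && walk_above u 0 k.+1.
Proof. by rewrite /merged -(addn1 k.+1) iotaD has_cat /= orbF addn1. Qed.

(** With [v = k - u k], the admissible values of [a - c] form the intervals
    [[u k, v]] and [[u k - d, v - d]] before the merging, and [[u k - d, v]]
    after it.  The cases overlap harmlessly: a walk that is still nonnegative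
    may have merged already, and then the two intervals lie in the large one.
    The step of the induction is linear arithmetic, given that two intervals of
    length at least [d] are contiguous and that an empty interval remains so. *)
Lemma peel_two_layers (s : nat -> bool) (u : nat -> nat) (a d k c : nat) :
    0 < d -> u 0 = 0 -> (forall j, u j.+1 = u j + s j) ->
  peel s (fun b => (b == a) || (b == a + d)) k c =
    walk_above u 0 k && ((a + u k <= c + k) && (c + u k <= a)
                      || (a + d + u k <= c + k) && (c + u k <= a + d))
 || [&& merged u d k, walk_above u d k, a + u k <= c + k & c + u k <= a + d].
Proof.
move=> d0 u0 uS; elim: k c => [|k IH] c /=.
  by rewrite /merged /walk_above /= u0 muln0 !addn0 !add0n /= !andbT; lia.
have wk t : walk_above u t k -> 2 * u k <= k + t.
  by move/walk_aboveP; apply.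
have w0d : walk_above u 0 k -> walk_above u d k.
  by move=> /walk_aboveP w; apply/walk_aboveP => j /w; lia.
have wm : walk_above u 0 k -> 2 * u k + d <= k.+1 -> merged u d k.
  by move=> *; apply/mergedP; exists k.
rewrite !IH mergedS !walk_aboveS uS; have := (wk 0, wk d).
move: (merged u d k) (walk_above u 0 k) (walk_above u d k) w0d wm.
move=> m w0 wd w0d wm [wk0 wkd]; case: (s k) => /=;
  case: w0 w0d wm wk0; case: wd wkd; case: m; lia.
Qed.

Lemma leq_count_nth (e : seq nat) i j : sorted ltn e -> 0 < i <= size e ->
  (i <= count (fun y => y <= j) e) = (nth 0 e i.-1 <= j).
Proof.
rewrite ltn_sorted_uniq_leq => /andP[_ se] /andP[i0 ie].
apply/idP/idP => [le_i|].
  by apply: (@nth_count_le _ nat j 0 e i.-1 se); rewrite prednK.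
apply: contraLR; rewrite -!ltnNge => lt_i.
have := @nth_count_gt _ nat j 0 e i.-1 se.
by apply; rewrite -ltnS prednK // ie andbT.
Qed.

(** * The increasing enumeration of a set and its counting function *)

Section Elements.

Variable n : nat.
Implicit Types (S : {set 'I_n}).

Definition elts S : seq nat := [seq (x : 'I_n).+1 | x <- enum S].

Definition upto S j := count (fun y => y <= j) (elts S).

Lemma size_elts S : size (elts S) = #|S|.
Proof. by rewrite size_map -cardE. Qed.

Lemma sorted_elts S : sorted ltn (elts S).
Proof.
rewrite sorted_map; apply: (@subseq_sorted _ _ _ (enum S) (enum 'I_n)).
- by move=> y x z; apply: ltn_trans.
- by rewrite enumT; apply: filter_subseq.
by rewrite -(@sorted_map _ _ val ltn) val_enum_ord iota_ltn_sorted.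
Qed.

Lemma uniq_elts S : uniq (elts S).
Proof. by have := sorted_elts S; rewrite ltn_sorted_uniq_leq => /andP[]. Qed.

Lemma mem_elts S (x : 'I_n) : (x.+1 \in elts S) = (x \in S).
Proof. by rewrite mem_map ?mem_enum // => y z [/val_inj]. Qed.

Lemma elts_bound S y : y \in elts S -> 0 < y <= n.
Proof. by case/mapP => x _ ->; rewrite ltn_ord. Qed.

Lemma elts_inj : injective elts.
Proof. by move=> S S' eS; apply/setP => x; rewrite -!mem_elts eS. Qed.

Lemma elts_set_of_seq (e : seq nat) :
  sorted ltn e -> {in e, forall y, 0 < y <= n} -> elts (set_of_seq n e) = e.
Proof.
move=> se ebound; apply: (irr_sorted_eq ltn_trans ltnn (sorted_elts _) se) => y.
apply/idP/idP => [/mapP[x]|ye]; first by rewrite mem_enum inE => ? ->.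
have := ebound y ye; case: y ye => // y ye lt_yn.
by rewrite (mem_elts _ (Ordinal lt_yn)) inE.
Qed.

(** The Galois connection between the enumeration of [S] and its counting
    function, which translates between elements of [S] and its walk. *)
Lemma leq_upto S i j : 0 < i <= #|S| -> (i <= upto S j) = (elt S i <= j).
Proof. by rewrite -size_elts => /leq_count_nth->//; apply: sorted_elts. Qed.

Lemma upto0 S : upto S 0 = 0.
Proof.
apply/eqP; rewrite -leqn0 leqNgt -has_count; apply/hasPn => y /elts_bound.
by rewrite leqn0 -lt0n => /andP[].
Qed.

Lemma uptoS S j : upto S j.+1 = upto S j + (j.+1 \in elts S).
Proof.
rewrite /upto -(count_uniq_mem _ (uniq_elts S)) -count_predUI.
rewrite [X in _ + X](@eq_count _ _ pred0) ?count_pred0 ?addn0 => [|y /=]; last first.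
  by case: eqP => [->|]; rewrite ?ltnn ?andbF.
by apply: eq_count => y /=; rewrite leq_eqVlt orbC.
Qed.

Lemma upto_n S : upto S n = #|S|.
Proof.
rewrite -size_elts; apply/eqP; rewrite -all_count.
by apply/allP => y /elts_bound/andP[].
Qed.

Lemma upto_card S j : upto S j <= #|S|.
Proof. by rewrite -size_elts count_size. Qed.

Lemma elt_bound S i : 0 < i <= #|S| -> 0 < elt S i <= n.
Proof.
move=> i_bound; apply: (@elts_bound S); apply: mem_nth.
by rewrite size_elts; lia.
Qed.

Lemma upto_elt S i : 0 < i <= #|S| -> i <= upto S (elt S i).
Proof. by move=> i_bound; rewrite leq_upto. Qed.

Lemma elt_upto S j : 0 < upto S j -> elt S (upto S j) <= j.
Proof. by move=> u0; rewrite -leq_upto // u0 upto_card. Qed.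

Lemma t_ballotP t S :
  reflect (forall i, 0 < i <= #|S| -> 2 * i <= elt S i + t) (t_ballot t S).
Proof.
by apply: (iffP allP) => b i; have := b i; rewrite mem_iota add1n ltnS.
Qed.

(** The walk attains its successive minima right after the elements of [S], so
    it suffices to look at it there. *)
Lemma t_ballot_walk t S : t_ballot t S = walk_above (upto S) t n.
Proof.
apply/t_ballotP/walk_aboveP => [b j _|w i i_bound].
  case: (posnP (upto S j)) => [->//|u0]; have := elt_upto u0.
  by have := b (upto S j); rewrite u0 upto_card => /(_ isT); lia.
have /andP[_ /w] := elt_bound i_bound; have := upto_elt i_bound; lia.
Qed.

Lemma osh_two_layers a d S : 0 < d -> ~~ ballot S ->
  osh (layer n a :|: layer n (a + d)) S <->
  [/\ merged (upto S) d n, t_ballot d S, a + #|S| <= n & #|S| <= a + d].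
Proof.
move=> d0 /negbTE nbS; rewrite /osh.
have -> : layer n a :|: layer n (a + d) =
          [set C : {set 'I_n} | (#|C| == a) || (#|C| == a + d)].
  by apply/setP => C; rewrite !inE.
rewrite (@order_shatters_peel _ (fun c => (c == a) || (c == a + d)) _
           (fun j => j.+1 \in elts S)); last exact: mem_elts.
rewrite (@peel_two_layers _ (upto S)) ?upto0 //; last exact: uptoS.
rewrite -!t_ballot_walk -/(ballot S) nbS upto_n.
by split=> [/and4P|?]; last exact/and4P.
Qed.

End Elements.

(** * The minimal non-ballot sets *)

(** The least possible [i]-th element of a set of the kind described in
    [osh_dominates], when [m] elements precede the visit of the walk to height
    [d - 1]. *)
Definition lowest d m i :=
  if i <= m then 2 * i else maxn (2 * i - d) (m + d + i).-1.

Definition dominates n (f : nat -> nat) (S : {set 'I_n}) :=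
  forall i, 0 < i <= #|S| -> f i <= elt S i.

Lemma upto_lipschitz n (S : {set 'I_n}) p q :
  p <= q -> upto S q <= upto S p + (q - p).
Proof.
elim: q => [|q IH]; first by rewrite leqn0 => /eqP->; rewrite addn0.
rewrite leq_eqVlt => /predU1P[->|/[!ltnS] lepq]; first by rewrite subnn addn0.
by have := IH lepq; rewrite uptoS; case: (_ \in _); lia.
Qed.

Lemma nonballot_card n d m (S : {set 'I_n}) :
  dominates (lowest d m) S -> ~~ ballot S -> m + d <= #|S|.
Proof.
move=> mS nbS; rewrite leqNgt; apply: contra nbS => ltS.
apply/t_ballotP => i i_bound.
by have := mS i i_bound; rewrite /lowest; case: ifP; lia.
Qed.

(** When the walk is at height at least [d - 1] after [p] steps and [m] elements
    of [S] are at most [p], then [p >= 2 m + d - 1], so that the elements after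
    the [m]-th are at least [2 m + d], [2 m + d + 1], and so on.  Conversely,
    these bounds let the walk reach height [d - 1] at step [2 m + d - 1],
    provided that this is at most [n]; it is because a non-ballot set has more
    than [m] elements. *)
Lemma osh_dominates n a d (S : {set 'I_n}) : 0 < d -> ~~ ballot S ->
  osh (layer n a :|: layer n (a + d)) S <->
  [/\ exists m, dominates (lowest d m) S, a + #|S| <= n & #|S| <= a + d].
Proof.
move=> d0 nbS; rewrite (osh_two_layers _ d0 nbS); split.
  case=> /mergedP[p lepn [up /walk_aboveP w]] /t_ballotP b ? ?; split=> //.
  exists (upto S p) => i i_bound.
  have := b i i_bound; have := upto_elt i_bound; rewrite /lowest.
  case: (leqP i (upto S p)) => [|lt_i lei].
    by rewrite leq_upto // => /w; lia.
  have ltp : p < elt S i by rewrite ltnNge -leq_upto // -ltnNge.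
  have := upto_lipschitz S (ltnW ltp); have := upto_elt i_bound; lia.
case=> -[m mS] ? ?; have mdS := nonballot_card mS nbS.
split=> //; last first.
  apply/t_ballotP => i i_bound.
  by have := mS i i_bound; rewrite /lowest; case: ifP; lia.
have beyond i : m < i <= #|S| -> 2 * m + d <= elt S i.
  by move=> i_bound; have := mS i; rewrite /lowest leqNgt; case: ifP; lia.
have before j : j < 2 * m + d -> upto S j <= m.
  move=> ltj; rewrite leqNgt; apply/negP => ltm.
  have := elt_upto (leq_trans (ltn0Sn m) ltm).
  by have := beyond (upto S j); rewrite ltm upto_card; lia.
have ltp : 2 * m + d <= n.
  by have := @elt_bound _ S m.+1; have := beyond m.+1; lia.
apply/mergedP; exists (2 * m + d).-1; first by lia.
split; first by have := before (2 * m + d).-1; lia.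
apply/walk_aboveP => j lej; have [->//|u0] := posnP (upto S j).
have := before j; have := elt_upto u0; have := mS (upto S j).
by rewrite u0 upto_card /lowest => /(_ isT); case: ifP; lia.
Qed.

Lemma lowest_homo d m : 0 < d -> {homo lowest d m : i j / i < j}.
Proof. by move=> d0 i j ltij; rewrite /lowest; do 2!case: ifP; lia. Qed.

(** It suffices to compare at [i = m' + 1], the first element after the gap for
    [m']: it is larger than [2 (m' + 1)] as [d > 2], and it is larger than the
    corresponding element for [m] if [m < m']. *)
Lemma lowest_inj d m m' k : 2 < d -> m' + d <= k ->
  (forall i, 0 < i <= k -> lowest d m' i <= lowest d m i) -> m' = m.
Proof.
move=> d2 lek /(_ m'.+1); rewrite /lowest ltnn; case: ifP; lia.
Qed.

Definition lowest_set n d m k : {set 'I_n} :=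
  set_of_seq n [seq lowest d m i | i <- iota 1 k].

Section LowestSet.

Variables n d m k : nat.
Hypotheses (d0 : 0 < d) (lekn : lowest d m k <= n).

Let L := lowest_set n d m k.

Lemma elts_lowest_set : elts L = [seq lowest d m i | i <- iota 1 k].
Proof.
apply: elts_set_of_seq.
  exact: (homo_sorted (lowest_homo m d0)) (iota_ltn_sorted _ _).
move=> _ /mapP[i + ->]; rewrite mem_iota => i_bound.
apply/andP; split; first by rewrite /lowest; case: ifP; lia.
by apply: leq_trans lekn; rewrite (ltnW_homo (lowest_homo m d0)) //; lia.
Qed.

Lemma card_lowest_set : #|L| = k.
Proof. by rewrite -size_elts elts_lowest_set size_map size_iota. Qed.

Lemma elt_lowest_set i : 0 < i <= k -> elt L i = lowest d m i.
Proof.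
move=> i_bound; rewrite /elt -/(elts L) elts_lowest_set.
rewrite (nth_map 0) ?size_iota; last by lia.
by rewrite nth_iota ?add1n ?prednK; lia.
Qed.

Lemma lowest_set_dominates : dominates (lowest d m) L.
Proof. by move=> i; rewrite card_lowest_set => ?; rewrite elt_lowest_set. Qed.

(** The difference [2 i - lowest d m i] does not decrease with [i] beyond [m]:
    it is the smaller of [d] and [i - m - d + 1], so it is largest at [i = k]. *)
Lemma tmin_lowest_set : m + d <= k -> tmin L = minn d (k - m - d + 1).
Proof.
move=> lek; rewrite /tmin; case: ex_minnP => t /t_ballotP.
rewrite card_lowest_set => b tmin.
apply/eqP; rewrite eqn_leq; apply/andP; split.
  apply: tmin; apply/t_ballotP => i; rewrite card_lowest_set => i_bound.
  by rewrite elt_lowest_set // /lowest; case: ifP; lia.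
have k_bound : 0 < k <= k by lia.
by have := b k k_bound; rewrite elt_lowest_set // /lowest; case: ifP; lia.
Qed.

End LowestSet.

(** Being non-ballot is inherited by smaller sets, so a set that is minimal in
    osh and non-ballot is minimal among the non-ballot members of osh.  The
    latter are, size by size, the non-ballot sets above some [lowest_set]. *)
Lemma minimal_nonballotP n a d (S : {set 'I_n}) : 2 < d ->
  (prec_minimal (osh (layer n a :|: layer n (a + d))) S /\ ~~ ballot S) <->
  exists m k, [/\ S = lowest_set n d m k, m + d <= k, lowest d m k <= n,
                  a + k <= n & k <= a + d].
Proof.
move=> d2; have d0 : 0 < d by lia.
have nonballot (T : {set 'I_n}) m k : #|T| = k -> m + d <= k ->
    (forall i, 0 < i <= k -> elt T i <= lowest d m i) -> ~~ ballot T.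
  move=> cT lek le; apply/negP => /t_ballotP/(_ (m + d)).
  by have := le (m + d); rewrite cT /lowest; case: ifP; lia.
split=> [[[oshS minS] nbS]|[m [k [-> lek lekn leank leka]]]].
  have /(osh_dominates _ d0 nbS)[[m mS] leank leka] := oshS.
  have lek := nonballot_card mS nbS; set k := #|S| in leank leka lek.
  have k_bound : 0 < k <= #|S| by rewrite /k; lia.
  have lekn : lowest d m k <= n.
    by apply: leq_trans (mS k k_bound) _; case/andP: (elt_bound k_bound).
  exists m, k; split=> //; apply/eqP/negP => /negP/eqP neS.
  have cL := card_lowest_set d0 lekn; have eL := elt_lowest_set d0 lekn.
  case: minS; exists (lowest_set n d m k); split.
    have nbL : ~~ ballot (lowest_set n d m k).
      by apply: (nonballot _ m k) => // i i_bound; rewrite eL.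
    apply/(osh_dominates _ d0 nbL); rewrite cL; split=> //.
    by exists m; apply: lowest_set_dominates.
  split; last by move/esym.
  by split=> // i; rewrite cL => i_bound; rewrite eL //; apply: mS.
have cL := card_lowest_set d0 lekn; have eL := elt_lowest_set d0 lekn.
have nbL : ~~ ballot (lowest_set n d m k).
  by apply: (nonballot _ m k) => // i i_bound; rewrite eL.
split=> //; split.
  apply/(osh_dominates _ d0 nbL); rewrite cL; split=> //.
  by exists m; apply: lowest_set_dominates.
case=> S' [oshS' [[cS' leS'] neS']]; case: neS'.
rewrite cL in cS'; rewrite cS' in leS'.
have leS'm i : 0 < i <= k -> elt S' i <= lowest d m i.
  by move=> i_bound; rewrite -eL //; apply: leS'.
have nbS' := nonballot _ _ _ cS' lek leS'm.
have /(osh_dominates _ d0 nbS')[[m' m'S'] _ _] := oshS'.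
have := nonballot_card m'S' nbS'; rewrite cS' => lem'k.
rewrite /dominates cS' in m'S'.
(* The minimal set that [S'] dominates is then below the given one. *)
have mm' : m' = m.
  apply: lowest_inj d2 lem'k _ => i i_bound.
  by apply: leq_trans (m'S' i _) (leS'm i _).
apply: elts_inj; apply: (@eq_from_nth _ 0); rewrite !size_elts ?cL // cS'.
move=> i lti; have i_bound : 0 < i.+1 <= k by lia.
have := eL _ i_bound; have := leS'm _ i_bound; have := m'S' _ i_bound.
by rewrite mm' /elt /= -/(elts _) -/(elts _); lia.
Qed.

Lemma map_lowest_evens d m : [seq lowest d m i | i <- iota 1 m] = evens m.
Proof.
apply/eq_in_map => i; rewrite mem_iota => i_bound.
by rewrite /lowest; case: ifP; lia.
Qed.

Lemma S_mjE n d m j : j < d -> S_mj n d m j = lowest_set n d m (m + d + j).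
Proof.
move=> ltjd; congr set_of_seq; rewrite -(addnA m) iotaD map_cat map_lowest_evens.
congr (_ ++ _); apply: (@eq_from_nth _ 0); rewrite size_iota ?size_map ?size_iota.
  by lia.
move=> i lti; rewrite (nth_map 0) ?size_iota ?nth_iota; try lia.
by rewrite /lowest; case: ifP; lia.
Qed.

Lemma S'_mrE n d m r : 0 < d -> S'_mr n d m r = lowest_set n d m (m + 2 * d + r).
Proof.
move=> d0; congr set_of_seq.
have -> : m + 2 * d + r = m + ((2 * d).-1 + r.+1) by lia.
rewrite iotaD map_cat map_lowest_evens iotaD map_cat.
congr (_ ++ (_ ++ _)); apply: (@eq_from_nth _ 0); rewrite ?size_map ?size_iota //; try lia;
  move=> i lti; rewrite !(nth_map 0) ?size_iota ?nth_iota; try lia;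
  by rewrite /lowest; case: ifP; lia.
Qed.

Theorem theorem4p8 (d a n : nat) (hd : 2 < d) (han : a + d <= n)
    (S : {set 'I_n}) :
  (prec_minimal (osh (layer n a :|: layer n (a + d))) S /\ ~~ ballot S) <->
  ((exists m j : nat,
      [/\ S = S_mj n d m j, tmin (S_mj n d m j) = j + 1
        & ((j + 1)%N%:Z <= M1 n a d m)%R]) \/
   (exists m r : nat,
      [/\ S = S'_mr n d m r, tmin (S'_mr n d m r) = d
        & (d%:Z <= M2 n a d m r)%R])).
Proof.
have d0 : 0 < d by lia.
rewrite minimal_nonballotP //; split.
  case=> m [k [-> lek lekn leank leka]].
  have tminL := tmin_lowest_set d0 lekn lek.
  have [ltk|gek] := ltnP k (m + 2 * d); [left|right].
    have kE : k = m + d + (k - m - d) by lia.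
    exists m, (k - m - d); rewrite S_mjE -?kE; last by lia.
    split=> //; first by rewrite tminL; lia.
    by move: lekn; rewrite /M1 /lowest; case: ifP; lia.
  have kE : k = m + 2 * d + (k - m - 2 * d) by lia.
  exists m, (k - m - 2 * d); rewrite S'_mrE // -kE.
  split=> //; first by rewrite tminL; lia.
  by move: lekn; rewrite /M2 /lowest; case: ifP; lia.
case=> -[m [j [-> _]]]; rewrite /M1 /M2 => lej.
  have ltjd : j < d by lia.
  exists m, (m + d + j); rewrite S_mjE //.
  by split; rewrite // /lowest; try case: ifP; lia.
exists m, (m + 2 * d + j); rewrite S'_mrE //.
by split; rewrite // /lowest; try case: ifP; lia.
Qed.
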